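(* Let $\mathrm{pen}$ be a real-valued polyhedral gauge on $\mathbb{R}^p$, $X\in\mathbb{R}^{n\times p}$ and $\lambda>0$. Then the solution set $S_{X,\lambda\mathrm{pen}}(y)$ is a singleton for all $y\in\mathbb{R}^n$ if and only if $\mathrm{row}(X)$ does not intersect a face of $B^*$ whose dimension is strictly less than $\mathrm{def}(X) = \dim(\ker(X))$.
   Context: A prime denotes transpose. A real-valued polyhedral gauge on $\mathbb{R}^p$ is a function of the form $\mathrm{pen}(b) = \max\{u_1'b,\dots,u_k'b\}$ for some $u_1,\dots,u_k \in \mathbb{R}^p$ with $u_1 = 0$. The associated polytope is $B^* = \mathrm{conv}(u_1,\dots,u_k)$ (it equals the subdifferential of $\mathrm{pen}$ at $0$). $S_{X,\lambda\mathrm{pen}}(y) = \mathrm{Arg}\min_{b\in\mathbb{R}^p} \frac12\|y-Xb\|_2^2 + \lambda\,\mathrm{pen}(b)$. $\mathrm{row}(X)$ is the column space of $X'$. A face of a polytope $P$ is a set of the form $\{x\in P : a'x = c\}$ where $a\in\mathbb{R}^p$, $c\in\mathbb{R}$ satisfy $a'x\le c$ for all $x\in P$ (so $P$ itself is a face); the dimension of a face is the dimension of its affine hull. *)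

(* Defs.v *)
From HB Require Import structures.
From mathcomp Require Import all_boot all_order all_algebra.
From mathcomp Require Import boolp classical_sets reals.

Set Implicit Arguments.
Unset Strict Implicit.
Unset Printing Implicit Defensive.

Import Order.TTheory GRing.Theory Num.Theory.

Local Open Scope classical_set_scope.
Local Open Scope ring_scope.

Definition dotv (R : realType) (m : nat) (a b : 'cV[R]_m) : R :=
  \sum_(i < m) a i 0 * b i 0.

(* the norm carried by matrices in the library is the sup norm *)
Definition l2norm (R : realType) (m : nat) (a : 'cV[R]_m) : R :=
  Num.sqrt (dotv a a).

Definition pen (R : realType) (p k : nat) (u : 'I_k.+1 -> 'cV[R]_p)
    (b : 'cV[R]_p) : R :=
  \big[Num.max/dotv (u ord0) b]_(i < k.+1) dotv (u i) b.

Definition convex_hull (R : realType) (p k : nat) (u : 'I_k.+1 -> 'cV[R]_p) :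
    set 'cV[R]_p :=
  [set x | exists t : 'I_k.+1 -> R,
     [/\ forall i, 0 <= t i, \sum_i t i = 1 & x = \sum_i t i *: u i]].

Definition solution_set (R : realType) (n p : nat) (X : 'M[R]_(n, p))
    (lambda : R) (g : 'cV[R]_p -> R) (y : 'cV[R]_n) : set 'cV[R]_p :=
  let obj b := 2^-1 * l2norm (y - X *m b) ^+ 2 + lambda * g b in
  [set b | forall b', obj b <= obj b'].

Definition row_set (R : realType) (n p : nat) (X : 'M[R]_(n, p)) :
    set 'cV[R]_p :=
  [set x | exists w : 'cV[R]_n, x = X^T *m w].

Definition dim_ker (R : realType) (n p : nat) (X : 'M[R]_(n, p)) : nat :=
  \dim (lker (linfun (mulmx X : 'cV[R]_p -> 'cV[R]_n))).

Definition face (R : realType) (p : nat) (P F : set 'cV[R]_p) : Prop :=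
  exists (a : 'cV[R]_p) (c : R),
    (forall x, P x -> dotv a x <= c) /\ F = [set x | P x /\ dotv a x = c].

Definition affine_set (R : realType) (p : nat) (A : set 'cV[R]_p) : Prop :=
  forall x y t, A x -> A y -> A ((1 - t) *: x + t *: y).

Definition affine_hull (R : realType) (p : nat) (S : set 'cV[R]_p) :
    set 'cV[R]_p :=
  smallest (@affine_set R p) S.

(* The affine hull of S is a translate of a linear subspace of dimension d.
   By the two lemmas below, every nonempty S has exactly one such d; the empty
   set has none. *)
Definition has_dim (R : realType) (p : nat) (S : set 'cV[R]_p) (d : nat) :
    Prop :=
  exists (x : 'cV[R]_p) (V : {vspace 'cV[R]_p}),
    affine_hull S = [set x + v | v in [set` V]] /\ \dim V = d.

Lemma affine_affine_hull (R : realType) (p : nat) (S : set 'cV[R]_p) :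
  affine_set (affine_hull S).
Proof.
move=> x y t Sx Sy A AP; apply: AP.1.
  exact: Sx.
exact: Sy.
Qed.

Lemma has_dim_exists (R : realType) (p : nat) (S : set 'cV[R]_p) :
  S !=set0 -> exists d, has_dim S d.
Proof.
move=> [x Sx]; set A := affine_hull S.
have Aaff : affine_set A by apply: affine_affine_hull.
have Ax : A x by move=> B [_]; apply.
have AZ v t : A (x + v) -> A (x + t *: v).
  move=> Av; have := Aaff _ _ t Ax Av.
  by rewrite scalerDr addrA scalerBl scale1r subrK.
have AD v w : A (x + v) -> A (x + w) -> A (x + (v + w)).
  move=> Av Aw; have := Aaff _ _ 2^-1 Av Aw.
  have -> : 1 - 2^-1 = 2^-1 :> R.
    by rewrite [X in X - _](splitr 1) mul1r addrK.
  rewrite -scalerDr addrACA scalerDr -mulr2n -scaler_nat scalerA.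
  rewrite mulVf ?pnatr_eq0// scale1r => /(AZ _ 2).
  by rewrite scalerA mulfV ?pnatr_eq0// scale1r.
pose Q d := `[< exists V : {vspace 'cV[R]_p},
  \dim V = d /\ forall v, v \in V -> A (x + v) >].
have Q0 : exists d, Q d.
  exists 0%N; apply/asboolP; exists 0%VS; split; first by rewrite dimv0.
  by move=> v; rewrite memv0 => /eqP ->; rewrite addr0.
have Qle d : Q d -> (d <= \dim {: 'cV[R]_p})%N.
  by move=> /asboolP[V [<- _]]; apply/dimvS/subvf.
case: (ex_maxnP Q0 Qle) => d /asboolP[V [dV VA]] dmax.
exists d, x, V; split=> //; apply/seteqP.
split=> [z Az|_ [v /= Vv <-]]; last exact: VA.
exists (z - x); last by rewrite addrC subrK.
have /dmax : Q (\dim (V + <[z - x]>)%VS).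
  apply/asboolP; exists (V + <[z - x]>)%VS; split=> // w.
  move=> /memv_addP[v Vv [_ /vlineP[t ->] ->]].
  by apply: AD; [exact: VA|apply: AZ; rewrite addrC subrK].
rewrite -dV => dle.
have /eqP <- : (V + <[z - x]>)%VS == V.
  by rewrite eq_sym -(geq_leqif (dimv_leqif_eq (addvSl V _))).
by apply: subvP (addvSr _ _) _ (memv_line _).
Qed.

Lemma has_dim_unique (R : realType) (p : nat) (S : set 'cV[R]_p) (d e : nat) :
  has_dim S d -> has_dim S e -> d = e.
Proof.
move=> [x [V [HV <-]]] [y [W [HW <-]]].
have key (a b : 'cV[R]_p) (P Q : {vspace 'cV[R]_p}) :
    [set a + v | v in [set` P]] = [set b + v | v in [set` Q]] -> (P <= Q)%VS.
  move=> PQ; apply/subvP => v Pv.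
  have : [set a + v | v in [set` P]] (a + v) by exists v.
  have : [set a + v | v in [set` P]] a by exists 0; rewrite ?addr0//= mem0v.
  rewrite PQ => -[q /= Qq qa] [r /= Qr ra].
  have -> : v = r - q.
    by apply: (addrI a); rewrite -ra -[in RHS]qa addrACA subrr addr0.
  by rewrite memvB.
have VW := etrans (esym HV) HW.
by apply/eqP; rewrite eqn_leq (dimvS (key _ _ _ _ VW)) (dimvS (key _ _ _ _ (esym VW))).
Qed.

(* Main.v *)
Require Import Defs.
From HB Require Import structures.
From mathcomp Require Import all_boot all_order all_algebra.
From mathcomp Require Import boolp classical_sets reals.
From mathcomp Require Import functions topology normedtype derive.
From mathcomp Require Import ring lra.

(** Write B for the convex hull of the u_i.  The subdifferential of pen at a is
    the face of B exposed by a, and every nonempty face of B arises in this way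
    ([face_subdiff]).  By Fermat's rule ([solution_of_subdiff],
    [subdiff_of_solution]), b is a solution for y exactly when
    y = X b + lambda w for some w such that X' w lies in the face exposed by b.

    If row(X) meets a face of dimension less than dim ker X, exposed by a say,
    then a count of dimensions ([exists_orthogonal]) yields a nonzero h in ker X
    orthogonal to the direction of that face.  A small move from a along h
    changes neither X a nor pen a, so that a is not the only solution for a
    suitable y ([nonunique_of_face]).

    Conversely, suppose that row(X) avoids the faces of small dimension.  The
    key fact is [no_orthogonal_face]: if h in ker X is nonzero, no face that
    meets row(X) lies in the hyperplane orthogonal to h.  Indeed, let F be a
    face in that hyperplane and z a point of row(X) on F.  The direction V of F
    has dimension at least dim ker X, and both V and row(X) lie in the
    hyperplane, so they share a nonzero vector v ([row_vector_in]).
    Following z + s v until it leaves F leads to a point that still belongs to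
    row(X) and lies on a strictly smaller face; as there are finitely many u_i,
    this cannot go on forever.
    Two consequences finish the proof.
    - Existence.  If h in ker X is nonzero and pen h = 0, the face exposed by h
      contains the point u ord0 = 0 and is orthogonal to h, which is excluded.
      Hence the objective is coercive and attains its minimum
      ([solution_exists]).
    - Uniqueness.  If b and b' are two solutions, the exact expansion of the
      objective around b ([objective_sub]) gives X b = X b' and puts the point
      X' w of the face exposed by b on the face exposed by b' as well.  The face
      exposed by b + b' then contains X' w and is orthogonal to b' - b, hence
      b' = b.

    The polyhedral input is Farkas' lemma: it describes a face by linear
    inequalities ([subdiffP]) and provides the supporting hyperplane at the
    point where a ray leaves a face ([ray_exit]). *)

Set Implicit Arguments.
Unset Strict Implicit.
Unset Printing Implicit Defensive.

Import Order.TTheory GRing.Theory Num.Theory.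
Import numFieldNormedType.Exports.

Local Open Scope classical_set_scope.
Local Open Scope ring_scope.

(** * Inner product, orthogonality and Farkas' lemma *)

Section InnerProduct.
Variable R : realType.
Implicit Types m n p : nat.

Lemma dotvE m (a b : 'cV[R]_m) : dotv a b = (a^T *m b) 0 0.
Proof. by rewrite mxE; apply: eq_bigr => i _; rewrite mxE. Qed.

Lemma dotvC m (a b : 'cV[R]_m) : dotv a b = dotv b a.
Proof. by apply: eq_bigr => i _; rewrite mulrC. Qed.

Lemma dotvDr m (a b c : 'cV[R]_m) : dotv a (b + c) = dotv a b + dotv a c.
Proof. by rewrite !dotvE mulmxDr mxE. Qed.

Lemma dotvZr m (a b : 'cV[R]_m) s : dotv a (s *: b) = s * dotv a b.
Proof. by rewrite !dotvE -scalemxAr mxE. Qed.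

Lemma dotvNr m (a b : 'cV[R]_m) : dotv a (- b) = - dotv a b.
Proof. by rewrite -scaleN1r dotvZr mulN1r. Qed.

Lemma dotv0r m (a : 'cV[R]_m) : dotv a 0 = 0.
Proof. by rewrite -(scale0r 0) dotvZr mul0r. Qed.

Lemma dotvBr m (a b c : 'cV[R]_m) : dotv a (b - c) = dotv a b - dotv a c.
Proof. by rewrite dotvDr dotvNr. Qed.

Lemma dotvDl m (a b c : 'cV[R]_m) : dotv (b + c) a = dotv b a + dotv c a.
Proof. by rewrite dotvC dotvDr !(dotvC a). Qed.

Lemma dotvZl m (a b : 'cV[R]_m) s : dotv (s *: b) a = s * dotv b a.
Proof. by rewrite dotvC dotvZr dotvC. Qed.

Lemma dotvNl m (a b : 'cV[R]_m) : dotv (- b) a = - dotv b a.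
Proof. by rewrite dotvC dotvNr dotvC. Qed.

Lemma dotvBl m (a b c : 'cV[R]_m) : dotv (b - c) a = dotv b a - dotv c a.
Proof. by rewrite dotvDl dotvNl. Qed.

Lemma dotv0l m (a : 'cV[R]_m) : dotv 0 a = 0.
Proof. by rewrite dotvC dotv0r. Qed.

Lemma dotv_sumr m (I : finType) (a : 'cV[R]_m) (F : I -> 'cV[R]_m) :
  dotv a (\sum_i F i) = \sum_i dotv a (F i).
Proof. exact: (big_morph (dotv a) (dotvDr a) (dotv0r a)). Qed.

Lemma dotv_ge0 m (a : 'cV[R]_m) : 0 <= dotv a a.
Proof. by apply: sumr_ge0 => i _; rewrite -expr2 sqr_ge0. Qed.

Lemma dotv_eq0 m (a : 'cV[R]_m) : (dotv a a == 0) = (a == 0).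
Proof.
apply/eqP/eqP => [|->]; last by rewrite dotv0l.
move=> /psumr_eq0P a0; apply/matrixP => i j; rewrite (ord1 j) mxE.
have /eqP := a0 (fun i _ => sqr_ge0 (a i 0)) i isT.
by rewrite mulf_eq0 orbb => /eqP.
Qed.

Lemma dotv_gt0 m (a : 'cV[R]_m) : a != 0 -> 0 < dotv a a.
Proof. by move=> a0; rewrite lt0r dotv_eq0 a0 dotv_ge0. Qed.

Lemma dotv_trmxl n p (X : 'M[R]_(n, p)) (w : 'cV[R]_n) (b : 'cV[R]_p) :
  dotv (X^T *m w) b = dotv w (X *m b).
Proof. by rewrite !dotvE trmx_mul trmxK mulmxA. Qed.

Lemma l2norm_sqr m (a : 'cV[R]_m) : l2norm a ^+ 2 = dotv a a.
Proof. by rewrite sqr_sqrtr ?dotv_ge0. Qed.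

(** The inner products with a basis of U form a linear map into a space of
    dimension \dim U, so its restriction to V has a nonzero kernel. *)
Lemma exists_orthogonal p (U V : {vspace 'cV[R]_p}) : (\dim U < \dim V)%N ->
  exists v, [/\ v \in V, v != 0 & forall x, x \in U -> dotv v x = 0].
Proof.
move=> UV; pose e := vbasis U.
pose B : 'M[R]_(\dim U, p) := \matrix_(i, j) e`_i j 0.
pose f := linfun (mulmx B : 'cV[R]_p -> 'cV[R]_(\dim U)).
have fE v : f v = B *m v by rewrite lfunE.
have : (0 < \dim (V :&: lker f)%VS)%N.
  have : (\dim (f @: V)%VS <= \dim U)%N.
    by apply: leq_trans (dimvS (subvf _)) _; rewrite dimvf /dim/= muln1.
  move: UV; rewrite -(limg_ker_dim f V).
  by move: (\dim (V :&: lker f)%VS) => [|//]; rewrite add0n ltnNge => /negP.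
rewrite lt0n dimv_eq0 => /negP W0.
exists (vpick (V :&: lker f)%VS).
have := memv_pick (V :&: lker f)%VS.
rewrite memv_cap memv_ker fE => /andP[-> /eqP Bv]; split=> //.
  by apply/negP; rewrite vpick0.
move=> x xU; rewrite (coord_vbasis xU) dotv_sumr big1// => i _.
rewrite dotvZr dotvC.
suff -> : dotv e`_i (vpick (V :&: lker f)%VS) = 0 by rewrite mulr0.
by have := congr1 (fun M : 'cV_ _ => M i 0) Bv; rewrite !mxE => <-;
  apply: eq_bigr => j _; rewrite mxE.
Qed.

(** The columns of the cokernel of X span ker X, and a row vector that the
    cokernel annihilates belongs to the row space of X. *)
Lemma mem_row_set n p (X : 'M[R]_(n, p)) (v : 'cV[R]_p) :
  (forall r, X *m r = 0 -> dotv v r = 0) -> row_set X v.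
Proof.
move=> vr.
have : (v^T <= X)%MS.
  rewrite submxE; apply/eqP/matrixP => i j; rewrite (ord1 i) [RHS]mxE.
  have := vr (col j (cokermx X)).
  rewrite colE mulmxA mulmx_coker mul0mx -colE => /(_ erefl) <-.
  by rewrite mxE; apply: eq_bigr => l _; rewrite !mxE.
move=> /submxP[w vw]; exists w^T.
by rewrite -trmx_mul -vw trmxK.
Qed.

(** Induction on the number of generators, after Bartl.  If c_0 is needed, some
    x is nonpositive on the other generators but positive on d, hence positive
    on c_0.  Projecting along c_0 onto the hyperplane orthogonal to x leaves an
    instance with one generator fewer, and the sign of x on the c_i and on d
    makes the coefficient of c_0 nonnegative. *)
Lemma farkas m p (c : 'I_m -> 'cV[R]_p) (d : 'cV[R]_p) :
  (forall g, (forall i, dotv g (c i) <= 0) -> dotv g d <= 0) ->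
  exists t : 'I_m -> R, (forall i, 0 <= t i) /\ d = \sum_i t i *: c i.
Proof.
elim: m c d => [|m IH] c d cd.
  exists (fun=> 0); split=> //; rewrite big_ord0; apply/eqP.
  rewrite -dotv_eq0 eq_le dotv_ge0 andbT.
  by apply: cd => -[].
pose cS i := c (lift ord0 i).
have [H|/existsNP[x /not_implyP[xc /negP]]] :=
  pselect (forall g, (forall i, dotv g (cS i) <= 0) -> dotv g d <= 0).
  have [t [t0 ->]] := IH _ _ H.
  exists (fun i => oapp t 0 (unlift ord0 i)); split.
    by move=> i; case: unlift => //=.
  rewrite big_ord_recl unlift_none /= scale0r add0r.
  by apply: eq_bigr => i _; rewrite liftK.
rewrite -ltNge => xd.
have xc0 : 0 < dotv x (c ord0).
  rewrite ltNge; apply/negP => xc0.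
  suff : dotv x d <= 0 by rewrite leNgt xd.
  by apply: cd => i; case: (unliftP ord0 i) => [j ->|->//]; apply: xc.
pose s z := dotv x z / dotv x (c ord0).
pose red (z : 'cV[R]_p) := z - s z *: c ord0.
(* the test vector g is translated along x so as to vanish on c ord0 *)
have [|t [t0 dt]] := IH (fun i => red (cS i)) (red d).
  move=> g gc; pose g' := g - (dotv g (c ord0) / dotv x (c ord0)) *: x.
  have g'E z : dotv g' z = dotv g (red z).
    rewrite dotvBl dotvZl dotvBr dotvZr /s; congr (_ - _).
    by rewrite mulrAC [RHS]mulrC !mulrA.
  rewrite -g'E; apply: cd => i; case: (unliftP ord0 i) => [j ->|->].
    by rewrite g'E gc.
  by rewrite dotvBl dotvZl mulfVK ?subrr// gt_eqF.
exists (fun i => oapp t (s d - \sum_j t j * s (cS j)) (unlift ord0 i)); split.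
  move=> i; case: unliftP => [j _|_] /=; first exact: t0.
  rewrite subr_ge0; apply: (@le_trans _ _ 0).
    apply: sumr_le0 => j _; apply: mulr_ge0_le0 => //.
    by rewrite /s pmulr_lle0 ?invr_gt0.
  by rewrite divr_ge0 ?ltW.
rewrite big_ord_recl unlift_none/=.
rewrite [X in _ + X](_ : _ = \sum_i t i *: cS i); last first.
  by apply: eq_bigr => i _; rewrite liftK.
move/eqP: dt; rewrite subr_eq => /eqP dt.
rewrite [LHS]dt addrC scalerBl -addrA; congr (_ + _).
rewrite scaler_suml -sumrN -big_split/=; apply: eq_bigr => i _.
by rewrite /red scalerBr scalerA addrC.
Qed.
End InnerProduct.

(** * Faces of the polytope as subdifferentials of the gauge *)

Definition active (R : realType) (p k : nat) (u : 'I_k.+1 -> 'cV[R]_p)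
    (a : 'cV[R]_p) : pred 'I_k.+1 := fun i => dotv (u i) a == pen u a.

(** The subdifferential of the gauge at a, in the form of the face of the
    polytope that a exposes. *)
Definition subdiff (R : realType) (p k : nat) (u : 'I_k.+1 -> 'cV[R]_p)
    (a : 'cV[R]_p) : set 'cV[R]_p :=
  [set x | convex_hull u x /\ dotv a x = pen u a].

Section Gauge.
Variables (R : realType) (p k : nat) (u : 'I_k.+1 -> 'cV[R]_p).
Implicit Types (a b g h v x z : 'cV[R]_p) (c e : R).

Lemma dotv_col_mx m (g : 'cV[R]_(p + m)) x (s : 'cV[R]_m) :
  dotv g (col_mx x s) = dotv (usubmx g) x + dotv (dsubmx g) s.
Proof.
by rewrite /dotv big_split_ord/=; congr (_ + _);
  apply: eq_bigr => i _; rewrite ?col_mxEu ?col_mxEd mxE.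
Qed.

Lemma le_pen a i : dotv (u i) a <= pen u a.
Proof. exact: le_bigmax. Qed.

Lemma pen_attained a : exists i, active u a i.
Proof.
rewrite /active /pen; elim/big_ind: _ => [|x y [i /eqP <-] [j /eqP <-]|i _].
- by exists ord0.
- by case: leP => _; [exists j|exists i].
- by exists i.
Qed.

Lemma dotv_hull_le x g c :
  convex_hull u x -> (forall i, dotv g (u i) <= c) -> dotv g x <= c.
Proof.
move=> [t [t0 t1 ->]] gc; rewrite dotv_sumr -[leRHS]mul1r -t1 mulr_suml.
by apply: ler_sum => i _; rewrite dotvZr ler_wpM2l.
Qed.

Lemma dotv_le_pen a x : convex_hull u x -> dotv a x <= pen u a.
Proof. by move=> /dotv_hull_le; apply=> i; rewrite dotvC le_pen. Qed.

Lemma vertex_hull i : convex_hull u (u i).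
Proof.
exists (fun j => (j == i)%:R); split=> [j||].
- by rewrite ler0n.
- by rewrite (bigD1 i)//= eqxx big1 ?addr0// => j /negPf ->.
- rewrite (bigD1 i)//= eqxx scale1r big1 ?addr0// => j /negPf ->.
  by rewrite scale0r.
Qed.

Lemma subdiff_vertex a i : active u a i -> subdiff u a (u i).
Proof. by move=> /eqP ai; split; [exact: vertex_hull|rewrite dotvC]. Qed.

(** The face exposed by a is the convex hull of the points u_i active at a; this
    is the dual description of that hull.  That the linear inequalities suffice
    is Farkas' lemma. *)
Lemma subdiffP a z : subdiff u a z <->
  (forall g c, (forall i, active u a i -> dotv g (u i) <= c) -> dotv g z <= c).
Proof.
split=> [[[t [t0 t1 ->]] az] g c gc|H].
  have t_inactive i : ~~ active u a i -> t i = 0.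
    move=> iNa; have : \sum_j t j * (pen u a - dotv (u j) a) = 0.
      under eq_bigr do rewrite mulrBr.
      rewrite sumrB -mulr_suml t1 mul1r -az dotv_sumr; apply/eqP.
      by rewrite subr_eq0; apply/eqP/eq_bigr => j _; rewrite dotvZr dotvC.
    have s0 j : true -> 0 <= t j * (pen u a - dotv (u j) a).
      by rewrite mulr_ge0// subr_ge0 le_pen.
    move=> /(psumr_eq0P s0)/(_ i isT)/eqP; rewrite mulf_eq0 subr_eq0.
    by rewrite [pen u a == _]eq_sym -/(active u a i) (negPf iNa) orbF => /eqP.
  rewrite dotv_sumr -[leRHS]mul1r -t1 mulr_suml; apply: ler_sum => i _.
  rewrite dotvZr; have [ia|/t_inactive->] := boolP (active u a i).
    by rewrite ler_wpM2l// gc.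
  by rewrite !mul0r.
(* the extra coordinate 1 turns conical combinations into convex ones *)
pose lift1 x : 'cV[R]_(p + 1) := col_mx x (const_mx 1).
have [|t [t0 zE]] := @farkas R k.+1 (p + 1)
    (fun i => if active u a i then lift1 (u i) else 0) (lift1 z).
  move=> g gc; have oneE : dotv (dsubmx g) (const_mx 1) = dsubmx g 0 0.
    by rewrite /dotv big_ord1 [const_mx _ _ _]mxE mulr1.
  rewrite dotv_col_mx oneE -lerBrDr sub0r; apply: H => i ia.
  by have := gc i; rewrite ia dotv_col_mx oneE -lerBrDr sub0r.
pose s i := if active u a i then t i else 0.
have zs : lift1 z = \sum_i s i *: lift1 (u i).
  rewrite zE; apply: eq_bigr => i _; rewrite /s; case: ifP => //.
  by rewrite scaler0 scale0r.
have sz : z = \sum_i s i *: u i.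
  have := congr1 usubmx zs; rewrite col_mxKu linear_sum/= => ->.
  by apply: eq_bigr => i _; rewrite linearZ/= col_mxKu.
have s1 : \sum_i s i = 1.
  have := congr1 (fun M : 'cV_(p + 1) => dsubmx M 0 0) zs.
  rewrite col_mxKd mxE linear_sum/= summxE => ->.
  by apply: eq_bigr => i _; rewrite linearZ/= col_mxKd !mxE mulr1.
split; first by exists s; split=> // i; rewrite /s; case: ifP.
rewrite sz dotv_sumr -[RHS]mul1r -s1 mulr_suml; apply: eq_bigr => i _.
rewrite dotvZr /s; case: ifPn => [/eqP <-|_]; first by rewrite dotvC.
by rewrite !mul0r.
Qed.

Lemma subdiff_eq a z g c : subdiff u a z ->
  (forall i, active u a i -> dotv g (u i) = c) -> dotv g z = c.
Proof.
move=> /subdiffP az gc; apply/eqP; rewrite eq_le az => [/=|i /gc ->//].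
rewrite -lerN2 -dotvNl; apply: az => i /gc <-.
by rewrite dotvNl.
Qed.

Lemma subdiff_nonempty a : subdiff u a !=set0.
Proof.
by have [i ia] := pen_attained a; exists (u i); apply: subdiff_vertex.
Qed.

Lemma subdiff_face a : face (convex_hull u) (subdiff u a).
Proof. by exists a, (pen u a); split=> // x; apply: dotv_le_pen. Qed.

Lemma face_subdiff F z : face (convex_hull u) F -> F z ->
  exists a, F = subdiff u a.
Proof.
move=> [a [c [ac ->]]] [zu az]; exists a.
suff pen_c : pen u a = c by rewrite /subdiff pen_c.
apply/eqP; rewrite eq_le -{2}az dotv_le_pen// andbT.
have [i /eqP <-] := pen_attained a.
by rewrite dotvC ac//; apply: vertex_hull.
Qed.

(** A point u_i that is inactive at a misses the maximum by a positive gap,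
    which a small perturbation of a cannot close. *)
Lemma active_perturb a g : exists2 e0, 0 < e0 &
  forall e i, 0 < e -> e <= e0 -> active u (a + e *: g) i -> active u a i.
Proof.
pose gap i := pen u a - dotv (u i) a.
(* the default 1 covers the case where every u_i is active *)
pose m := \big[Num.min/1]_(i | ~~ active u a i) gap i.
have m0 : 0 < m.
  apply: lt_bigmin => // i iNa; rewrite subr_gt0 lt_neqAle le_pen andbT.
  by rewrite -/(active u a i).
pose M := \sum_i `|dotv (u i) g|.
have M0 : 0 <= M by apply: sumr_ge0.
have leM i : `|dotv (u i) g| <= M.
  by rewrite /M (bigD1 i)//= lerDl sumr_ge0.
have M1 : 0 < 2 * M + 1 by lra.
exists (m / (2 * M + 1)); first by rewrite divr_gt0.
move=> e i e0 ee /eqP ia; apply/negPn/negP => iNa.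
have [j /eqP ja] := pen_attained a.
have := le_pen (a + e *: g) j; rewrite -ia !dotvDr !dotvZr ja.
have gm : m <= pen u a - dotv (u i) a by apply: bigmin_le_cond.
have eM : e * (2 * M + 1) <= m by rewrite -ler_pdivlMr.
have : e * dotv (u i) g <= e * M.
  by rewrite ler_wpM2l ?(ltW e0)// (le_trans (ler_norm _)).
have : - (e * dotv (u j) g) <= e * M.
  rewrite -mulrN ler_wpM2l ?(ltW e0)// (le_trans _ (leM j))//.
  by rewrite -normrN ler_norm.
lra.
Qed.

End Gauge.

(** * Descent along faces that meet the row space *)

Section Descent.
Variables (R : realType) (p k : nat) (u : 'I_k.+1 -> 'cV[R]_p).
Implicit Types (a b g h v x z : 'cV[R]_p) (c e : R).

(** The level set of g is an affine set containing F, hence contains the affine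
    hull of F. *)
Lemma dotv_direction F (V : {vspace 'cV[R]_p}) x g c :
  affine_hull F = [set x + v | v in [set` V]] ->
  (forall z, F z -> dotv g z = c) -> forall v, v \in V -> dotv g v = 0.
Proof.
move=> HV gF v vV.
have sub z : affine_hull F z -> dotv g z = c.
  move=> /(_ [set y | dotv g y = c]); apply; split=> // y y' t /= yc yc'.
  by rewrite dotvDr !dotvZr yc yc' -mulrDl subrK mul1r.
have x_hull : affine_hull F x by rewrite HV; exists 0; rewrite /= ?mem0v ?addr0.
have xv_hull : affine_hull F (x + v) by rewrite HV; exists v.
by move: (sub _ xv_hull); rewrite dotvDr (sub _ x_hull) -[RHS]addr0 => /addrI.
Qed.

(** The exit time is the supremum s of the times spent in the face; it is
    attained because the face is cut out by weak inequalities.  By Farkas,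
    either the required g exists or v is a conical combination of the vectors
    from the exit point to the active u_i, and in the latter case the ray stays
    in the face a little longer. *)
Lemma ray_exit a z v : subdiff u a z -> v != 0 ->
  exists s g, [/\ subdiff u a (z + s *: v),
    forall i, active u a i -> dotv g (u i) <= dotv g (z + s *: v) &
    0 < dotv g v].
Proof.
move=> az /dotv_gt0 vv0.
pose T := [set s | subdiff u a (z + s *: v)].
have T0 : T 0 by rewrite /T/= scale0r addr0.
have supT : has_sup T.
  split; first by exists 0.
  exists ((pen u v - dotv v z) / dotv v v) => s [/(dotv_le_pen v)].
  by rewrite dotvDr dotvZr -lerBrDl ler_pdivlMr.
have Tle s : T s -> s <= sup T by move=> Ts; apply: ub_le_sup => //; case: supT.
have Tsup : T (sup T).
  apply/subdiffP => g c gc; rewrite dotvDr dotvZr leNgt; apply/negP => c_lt.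
  have gT s : T s -> dotv g z + s * dotv g v <= c.
    by move=> /subdiffP/(_ g c gc); rewrite dotvDr dotvZr.
  have gz : dotv g z <= c by have := gT 0 T0; rewrite mul0r addr0.
  have sup0 : 0 <= sup T by apply: Tle.
  have gv0 : 0 < dotv g v by rewrite ltNge; apply/negP => gv; nra.
  suff : sup T <= (c - dotv g z) / dotv g v by rewrite ler_pdivlMr//; lra.
  apply: ge_sup; first by exists 0.
  by move=> s /gT; rewrite ler_pdivlMr//; lra.
exists (sup T); set z1 := z + _.
have [//|noexit] := pselect (exists g, [/\ subdiff u a z1,
    forall i, active u a i -> dotv g (u i) <= dotv g z1 & 0 < dotv g v]).
have [|t [t0 vE]] := @farkas R k.+1 p
    (fun i => if active u a i then u i - z1 else 0) v.
  move=> g gc; rewrite leNgt; apply/negP => gv; apply: noexit.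
  exists g; split=> // i ia.
  by have := gc i; rewrite ia dotvBr subr_le0.
pose M := \sum_i t i.
have M0 : 0 <= M by apply: sumr_ge0.
pose e := (1 + M)^-1.
have e0 : 0 < e by rewrite invr_gt0; lra.
have : T (sup T + e).
  (* e M <= 1 keeps a nonnegative weight on the point z1 itself *)
  rewrite /T/= scalerDl addrA -/z1; apply/subdiffP => g c gc.
  have gz1 : dotv g z1 <= c by move/subdiffP : Tsup; apply.
  have gvM : dotv g v <= M * (c - dotv g z1).
    rewrite {1}vE dotv_sumr /M mulr_suml; apply: ler_sum => i _.
    rewrite dotvZr ler_wpM2l//; case: ifP => [ia|_].
      by rewrite dotvBr lerB// gc.
    by rewrite dotv0r subr_ge0.
  have eM : e * M <= 1 by rewrite /e mulrC ler_pdivrMr; lra.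
  rewrite dotvDr dotvZr.
  apply: (@le_trans _ _ (dotv g z1 + (e * M) * (c - dotv g z1))).
    by rewrite lerD2l -mulrA ler_wpM2l// ltW.
  have : (e * M) * (c - dotv g z1) <= 1 * (c - dotv g z1).
    by rewrite ler_wpM2r// subr_ge0.
  lra.
by move=> /Tle; rewrite gerDl leNgt e0.
Qed.

(** The subface on which g is maximal is exposed by a + e g for small e > 0: a
    face of a face of a polytope is a face. *)
Lemma smaller_face a z g i0 : subdiff u a z ->
  (forall i, active u a i -> dotv g (u i) <= dotv g z) ->
  active u a i0 -> dotv g (u i0) != dotv g z ->
  exists a', [/\ subdiff u a' z, {subset active u a' <= active u a} &
    (#|active u a'| < #|active u a|)%N].
Proof.
move=> [zu az] gz i0a gi0.
have [e e0 /(_ e _ e0 (lexx e)) act] := active_perturb u a g.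
exists (a + e *: g).
have pen_a' : pen u (a + e *: g) = pen u a + e * dotv g z.
  apply/eqP; rewrite eq_le; apply/andP; split; last first.
    by rewrite -az -dotvZl -dotvDl dotv_le_pen.
  have [i ia'] := pen_attained u (a + e *: g).
  have ia := act _ ia'.
  rewrite -(eqP ia') dotvDr dotvZr (eqP ia) lerD2l ler_wpM2l ?(ltW e0)//.
  by rewrite dotvC gz.
have sub : {subset active u (a + e *: g) <= active u a} by move=> i /act.
split=> //; first by split=> //; rewrite pen_a' dotvDl dotvZl az.
apply: proper_card; apply/fintype.properP; split; first exact/fintype.subsetP.
exists i0 => //; apply/negP => /eqP; rewrite dotvDr dotvZr pen_a' (eqP i0a).
move=> /addrI/(mulfI (lt0r_neq0 e0)) gE.
by move: gi0; rewrite dotvC gE eqxx.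
Qed.

Variables (n : nat) (X : 'M[R]_(n, p)).

Let K := lker (linfun (mulmx X : 'cV[R]_p -> 'cV[R]_n)).

Lemma mem_ker v : (v \in K) = (X *m v == 0).
Proof. by rewrite memv_ker lfunE. Qed.

(** The subspace of ker X orthogonal to h has dimension less than dim ker X, so
    V contains a nonzero v orthogonal to it.  As v is also orthogonal to h, it
    is orthogonal to all of ker X. *)
Lemma row_vector_in (V : {vspace 'cV[R]_p}) h :
  h != 0 -> X *m h = 0 -> (forall v, v \in V -> dotv h v = 0) ->
  (dim_ker X <= \dim V)%N ->
  exists v, [/\ v \in V, v != 0 & row_set X v].
Proof.
move=> h0 Xh hV dV.
pose f := linfun (mulmx h^T : 'cV[R]_p -> 'cV[R]_1).
have fE x : (x \in lker f) = (dotv h x == 0).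
  rewrite memv_ker lfunE/= dotvE; apply/eqP/eqP => [->|fx]; first by rewrite mxE.
  by apply/matrixP => i j; rewrite !ord1 fx mxE.
have hh : 0 < dotv h h by apply: dotv_gt0.
have : (\dim (K :&: lker f)%VS < \dim V)%N.
  apply: leq_trans dV; rewrite ltnNge; apply/negP => Kle.
  have /eqP KE : (K :&: lker f)%VS == K by rewrite eqEdim capvSl.
  have : h \in K by rewrite mem_ker Xh.
  by rewrite -KE memv_cap fE gt_eqF// andbF.
move=> /exists_orthogonal[v [vV v0 vK]]; exists v; split=> //.
apply: mem_row_set => r Xr.
have vh : dotv v h = 0 by rewrite dotvC hV.
have : dotv v (r - (dotv h r / dotv h h) *: h) = 0.
  apply: vK; rewrite memv_cap fE mem_ker mulmxBr -scalemxAr Xh Xr scaler0 subr0.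
  by rewrite eqxx dotvBr dotvZr divfK ?subrr ?eqxx ?(gt_eqF hh).
by rewrite dotvBr dotvZr vh mulr0 subr0.
Qed.

(** Induction on the number of u_i active at a: inside the face exposed by a, a
    move along a common direction of the face and of row(X) reaches a smaller
    face that still meets row(X). *)
Lemma no_orthogonal_face h :
  (forall (F : set 'cV[R]_p) (d : nat),
     face (convex_hull u) F -> has_dim F d -> (d < dim_ker X)%N ->
     row_set X `&` F = set0) ->
  h != 0 -> X *m h = 0 ->
  forall a z, row_set X z -> subdiff u a z ->
  ~ (forall i, active u a i -> dotv h (u i) = 0).
Proof.
move=> faces h0 Xh a; have [m] := ubnP #|active u a|; elim: m a => // m IH a am.
move=> z rz az ha.
have [d dF] := has_dim_exists (subdiff_nonempty u a).
have [x [V [HV dV]]] := dF.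
have : (dim_ker X <= \dim V)%N.
  rewrite dV leqNgt; apply/negP => /(faces _ _ (subdiff_face u a) dF).
  by move=> /seteqP[/(_ z)+ _]; apply.
have hV v : v \in V -> dotv h v = 0.
  apply: (dotv_direction (c := 0) HV) => y ay; exact: (subdiff_eq ay ha).
move=> /(row_vector_in h0 Xh hV)[v [vV v0 [wv vE]]].
have [s [g [az1 gz1 gv]]] := ray_exit az v0.
have [i ia gi] : exists2 i, active u a i & dotv g (u i) != dotv g (z + s *: v).
  apply: contrapT => /forall2NP gconst.
  suff : dotv g v = 0 by move=> g0; rewrite g0 ltxx in gv.
  apply: (dotv_direction (c := dotv g (z + s *: v)) HV) => // y ay.
  apply: (subdiff_eq ay) => i ia; apply: contrapT => /eqP gi.
  by have [] := gconst i.
have [a' [az' suba' lta']] := smaller_face az1 gz1 ia gi.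
apply: (IH a' _ (z + s *: v)) => //.
- by rewrite (leq_trans lta').
- case: rz => w ->; exists (w + s *: wv).
  by rewrite mulmxDr -scalemxAr vE.
- by move=> j ja; apply/ha/suba'.
Qed.

End Descent.

(** * Continuity and minima of coercive functions *)

Section Existence.
Variables (R : realType) (p : nat).

Lemma continuous_min_of_sublevel (f : 'rV[R]_p -> R) (r : R) (x0 : 'rV[R]_p) :
  continuous f -> (forall x, r < `|x| -> f x0 <= f x) ->
  exists c, forall x, f c <= f x.
Proof.
move=> fc fr; pose r' := Num.max r `|x0|.
pose A := [set x : 'rV[R]_p | `|x| <= r'].
have Ax0 : A x0 by rewrite /A/= le_max lexx orbT.
have cA : compact A.
  apply: bounded_closed_compact.
    exists r'; split; first exact: num_real.
    by move=> M rM x /= /le_trans; apply; exact: ltW.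
  apply: (preimage_closed _ (@closed_le R _)) => x _; exact: norm_continuous.
have [|c cA' cmin] := @EVT_min_rV R p f A (ex_intro _ _ Ax0) cA.
  exact: continuous_subspaceT.
exists c => x; have [xr|xr] := leP `|x| r'; first by apply: cmin; rewrite inE.
apply: (@le_trans _ _ (f x0)); first by apply: cmin; rewrite inE.
by apply: fr; rewrite (le_lt_trans _ xr)// le_max lexx.
Qed.

Lemma positive_on_sphere (g : 'rV[R]_p -> R) : continuous g ->
  (forall x, x != 0 -> 0 < g x) ->
  exists2 m, 0 < m & forall x, `|x| = 1 -> m <= g x.
Proof.
move=> gc g0; pose A := [set x : 'rV[R]_p | `|x| = 1].
have [[x0 Ax0]|/forallNP noA] := pselect (A !=set0); last first.
  by exists 1 => // x x1; have := noA x.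
have cA : compact A.
  apply: bounded_closed_compact.
    exists 1; split; first exact: num_real.
    by move=> M rM x /= ->; exact: ltW.
  apply: (preimage_closed _ (@closed_eq R _)) => x _; exact: norm_continuous.
have [|c + cmin] := @EVT_min_rV R p g A (ex_intro _ _ Ax0) cA.
  exact: continuous_subspaceT.
rewrite inE /A/= => c1; exists (g c).
  by apply: g0; rewrite -normr_gt0 c1.
by move=> x x1; apply: cmin; rewrite inE.
Qed.

Lemma continuous_dotv_trmx (a : 'cV[R]_p) :
  continuous (fun x : 'rV[R]_p => dotv a x^T).
Proof.
rewrite /dotv; apply: (@continuous_big R _ +%R 0 _ _ _ _ _) => [|i _].
  exact: add_continuous.
have cont_coord : continuous (fun x : 'rV[R]_p => x^T i 0).
  by under eq_fun do rewrite mxE; exact: coord_continuous.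
by move=> x; apply: continuousM; [exact: cst_continuous|exact: cont_coord].
Qed.

Lemma continuous_residual n (X : 'M[R]_(n, p)) (y : 'cV[R]_n) :
  continuous (fun x : 'rV[R]_p => dotv (y - X *m x^T) (y - X *m x^T)).
Proof.
have cont_entry i : continuous (fun x : 'rV[R]_p => (y - X *m x^T) i 0).
  move=> x; rewrite (_ : (fun _ => _) =
      fun x : 'rV[R]_p => y i 0 - dotv (row i X)^T x^T); last first.
    apply/funext => z; rewrite !mxE; congr (_ - _).
    by apply: eq_bigr => j _; rewrite !mxE.
  by apply: (@continuousB R R _ (fun=> y i 0)
    (fun z : 'rV[R]_p => dotv (row i X)^T z^T));
    [exact: cst_continuous|exact: continuous_dotv_trmx].
rewrite /dotv; apply: (@continuous_big R _ +%R 0 _ _ _ _ _) => [|i _].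
  exact: add_continuous.
by move=> x; apply: continuousM; exact: cont_entry.
Qed.

Lemma continuous_pen_trmx k (u : 'I_k.+1 -> 'cV[R]_p) :
  continuous (fun x : 'rV[R]_p => pen u x^T).
Proof.
rewrite /pen; elim: (index_enum _) => [|i s IH].
  by under eq_fun do rewrite big_nil; exact: continuous_dotv_trmx.
under eq_fun do rewrite big_cons.
move=> x; apply: (@continuous_max R _ (fun z : 'rV[R]_p => dotv (u i) z^T));
  [exact: continuous_dotv_trmx|exact: IH].
Qed.

End Existence.

(** * Solutions of the penalized least squares problem *)

Definition objective (R : realType) (n p : nat) (X : 'M[R]_(n, p))
    (lambda : R) (g : 'cV[R]_p -> R) (y : 'cV[R]_n) (b : 'cV[R]_p) : R :=
  2^-1 * l2norm (y - X *m b) ^+ 2 + lambda * g b.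

(** When X' w is a subgradient at a, both terms on the right are nonnegative;
    this exact second-order expansion serves for the optimality condition in
    both directions as well as for uniqueness. *)
Lemma objective_sub (R : realType) (n p k : nat) (u : 'I_k.+1 -> 'cV[R]_p)
    (X : 'M[R]_(n, p)) (lambda : R) (y w : 'cV[R]_n) (a : 'cV[R]_p) :
  y = X *m a + lambda *: w ->
  forall b, objective X lambda (pen u) y b - objective X lambda (pen u) y a =
    2^-1 * dotv (X *m (b - a)) (X *m (b - a))
    + lambda * (pen u b - pen u a - dotv (X^T *m w) (b - a)).
Proof.
move=> yE b; rewrite /objective !l2norm_sqr dotv_trmxl.
have -> : y - X *m a = lambda *: w by rewrite yE addrC addKr.
have -> : y - X *m b = lambda *: w - X *m (b - a).
  by rewrite yE mulmxBr opprB addrAC addrC.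
move: (X *m (b - a)) => d.
rewrite !(dotvBl, dotvBr, dotvZl, dotvZr) (dotvC d w).
by field.
Qed.

Section Solutions.
Variables (R : realType) (n p k : nat) (u : 'I_k.+1 -> 'cV[R]_p).
Variables (X : 'M[R]_(n, p)) (lambda : R).
Hypothesis lambda_gt0 : 0 < lambda.

Lemma solution_of_subdiff y w a : y = X *m a + lambda *: w ->
  subdiff u a (X^T *m w) -> solution_set X lambda (pen u) y a.
Proof.
move=> yE [wu wa] b.
rewrite -[_ <= _]/(objective X lambda (pen u) y a <=
                   objective X lambda (pen u) y b).
rewrite -subr_ge0 (objective_sub u yE) addr_ge0//.
  by rewrite mulr_ge0 ?invr_ge0 ?dotv_ge0.
rewrite mulr_ge0 ?(ltW lambda_gt0)// dotvBr ![dotv (X^T *m w) _]dotvC wa.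
by have := dotv_le_pen b wu; lra.
Qed.

(** Otherwise a hyperplane separates X' w from the face exposed by b, and a
    small move from b along its normal g decreases the objective: only the u_i
    active at b determine the gauge nearby, so the first-order term is
    negative. *)
Lemma subdiff_of_solution y b : solution_set X lambda (pen u) y b ->
  exists w, y = X *m b + lambda *: w /\ subdiff u b (X^T *m w).
Proof.
move=> opt; pose w := lambda^-1 *: (y - X *m b); exists w.
have yE : y = X *m b + lambda *: w.
  by rewrite scalerA divff ?gt_eqF// scale1r addrC subrK.
split=> //; apply/subdiffP => g c gc; rewrite leNgt; apply/negP => c_lt.
have [e0 e0_gt0 act] := active_perturb u b g.
set q := dotv (X *m g) (X *m g); have q0 : 0 <= q by apply: dotv_ge0.
pose dl := lambda * (dotv g (X^T *m w) - c).
have dl0 : 0 < dl by rewrite mulr_gt0// subr_gt0.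
(* along e g the objective changes by at most e^2 q / 2 - e dl *)
pose e := Num.min e0 (dl / (q + 1)).
have e_gt0 : 0 < e by rewrite lt_min e0_gt0 divr_gt0//; lra.
have eq_le_dl : e * (q + 1) <= dl.
  by rewrite -ler_pdivlMr ?ge_min ?lexx ?orbT//; lra.
have [i ia'] := pen_attained u (b + e *: g).
have ia : active u b i by apply: act ia' => //; rewrite ge_min lexx.
have pen_le : pen u (b + e *: g) <= pen u b + e * c.
  rewrite -(eqP ia') dotvDr dotvZr (eqP ia) lerD2l ler_wpM2l ?(ltW e_gt0)//.
  by rewrite dotvC gc.
have := opt (b + e *: g).
rewrite -[_ <= _]/(objective X lambda (pen u) y b <=
                   objective X lambda (pen u) y (b + e *: g)).
rewrite -subr_ge0 (objective_sub u yE) [b + _]addrC addrK.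
rewrite [_ *: _ + b]addrC -scalemxAr dotvZl !dotvZr -/q [dotv _ g]dotvC.
apply/negP; rewrite -ltNge.
have : lambda * (pen u (b + e *: g) - pen u b - e * dotv g (X^T *m w))
    <= - e * dl.
  rewrite /dl mulrCA ler_wpM2l ?(ltW lambda_gt0)//; lra.
have : e * (e * (q + 1)) <= e * dl by rewrite ler_wpM2l// ltW.
have : 0 < e * e by rewrite mulr_gt0.
have : 0 <= e * e * q by rewrite !mulr_ge0// ltW.
nra.
Qed.

Lemma pen_scale_le s (b : 'cV[R]_p) : 0 <= s -> pen u (s *: b) <= s * pen u b.
Proof.
move=> s0; have [i /eqP <-] := pen_attained u (s *: b).
by rewrite dotvZr ler_wpM2l// le_pen.
Qed.

Hypothesis u0 : u ord0 = 0.

Lemma pen_ge0 (b : 'cV[R]_p) : 0 <= pen u b.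
Proof. by have := le_pen u b ord0; rewrite u0 dotv0l. Qed.

(** The function |X b|^2 + pen b, with the Euclidean norm of X b, is bounded
    below by some m > 0 on the unit sphere of the sup norm, hence by m times the
    sup norm of b outside of the unit ball.  Where the objective is below its
    value at 0, this function is bounded above, so b stays in a ball. *)
Lemma solution_exists (y : 'cV[R]_n) :
  (forall h, h != 0 -> X *m h = 0 -> 0 < pen u h) ->
  exists b, solution_set X lambda (pen u) y b.
Proof.
move=> pen_gt0.
pose res (z : 'cV[R]_n) (x : 'rV[R]_p) := dotv (z - X *m x^T) (z - X *m x^T).
have [||m m0 gm] := @positive_on_sphere R p (fun x => res 0 x + pen u x^T).
- by move=> x; apply: (@continuousD R R _ (res 0) (fun x => pen u x^T));
    [exact: continuous_residual|exact: continuous_pen_trmx].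
- move=> x x0; rewrite /res sub0r dotvNl dotvNr opprK.
  have [Xx|Xx] := eqVneq (X *m x^T) 0.
    rewrite Xx dotv0l add0r pen_gt0//; apply: contra_neq x0 => xT0.
    by rewrite -[x]trmxK xT0 trmx0.
  by rewrite ltr_pwDl ?dotv_gt0 ?pen_ge0.
pose f x := 2^-1 * res y x + lambda * pen u x^T.
have fc : continuous f.
  move=> x; apply: (@continuousD R R _ (fun x => 2^-1 * res y x)
    (fun x => lambda * pen u x^T)).
    apply: (@continuousM R _ (fun=> 2^-1) (res y)); first exact: cst_continuous.
    exact: continuous_residual.
  apply: (@continuousM R _ (fun=> lambda) (fun x => pen u x^T)).
    exact: cst_continuous.
  exact: continuous_pen_trmx.
(* if f x < f 0, then |X x|^2 <= 4 |y|^2 and pen x <= |y|^2 / (2 lambda) *)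
pose B := (4 * dotv y y + dotv y y / (2 * lambda)) / m.
have [x xr|c cmin] := @continuous_min_of_sublevel R p f (Num.max 1 B) 0 fc.
  move: xr; rewrite gt_max => /andP[x1 xB].
  have f0 : f 0 = 2^-1 * dotv y y.
    suff pen0 : pen u 0 = 0.
      by rewrite /f /res trmx0 mulmx0 subr0 pen0 mulr0 addr0.
    apply/eqP; rewrite eq_le pen_ge0 andbT.
    by have := @pen_scale_le 0 0 (lexx 0); rewrite scale0r mul0r.
  rewrite leNgt; apply/negP; rewrite f0 /f => flt.
  have r0 : 0 < `|x| by rewrite (lt_trans _ x1).
  have /gm : `| `|x|^-1 *: x| = 1.
    by rewrite normrZ normfV normr_id mulVf ?gt_eqF.
  have := @pen_scale_le `|x|^-1 x^T (ltW _); rewrite invr_gt0 => /(_ r0).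
  rewrite /res linearZ/= -scalemxAr !sub0r !dotvNl !dotvNr opprK dotvZl dotvZr.
  move=> pen_le m_le.
  have P0 := pen_ge0 x^T.
  have e_lt : res y x < dotv y y.
    have : 0 <= lambda * pen u x^T by rewrite mulr_ge0// ltW.
    by lra.
  have P_lt : pen u x^T < dotv y y / (2 * lambda).
    rewrite ltr_pdivlMr ?mulr_gt0//.
    have : 0 <= res y x by apply: dotv_ge0.
    by lra.
  have Q_le : dotv (X *m x^T) (X *m x^T) <= 2 * dotv y y + 2 * res y x.
    have -> : X *m x^T = y - (y - X *m x^T) by rewrite opprB addrC subrK.
    rewrite /res; move: (y - X *m x^T) => e.
    have := dotv_ge0 (y + e).
    by rewrite !(dotvDl, dotvDr, dotvNl, dotvNr) (dotvC e y); lra.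
  move: xB; rewrite ltr_pdivrMr// => mr.
  have : `|x| * m <= `|x|^-1 * dotv (X *m x^T) (X *m x^T) + pen u x^T.
    rewrite -[leRHS](mulVKf (lt0r_neq0 r0)) ler_pM2l// (le_trans m_le)//.
    by rewrite mulrDr lerD2l.
  have : `|x|^-1 * dotv (X *m x^T) (X *m x^T) <= 1 * dotv (X *m x^T) (X *m x^T).
    by rewrite ler_wpM2r ?dotv_ge0// invf_le1// ltW.
  by lra.
exists c^T => b'.
have := cmin b'^T; rewrite /f /res trmxK -!l2norm_sqr; exact.
Qed.
End Solutions.

(** The constant c is the value of h at X' w, which is 0 since h is in ker X.
    So the gauge does not change from a to a + e h for small e > 0, and X' w
    remains a subgradient. *)
Lemma nonunique_of_face (R : realType) (n p k : nat)
    (u : 'I_k.+1 -> 'cV[R]_p) (X : 'M[R]_(n, p)) (lambda : R)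
    (lambda_gt0 : 0 < lambda) (a h : 'cV[R]_p) (w : 'cV[R]_n) c :
  subdiff u a (X^T *m w) -> h != 0 -> X *m h = 0 ->
  (forall i, active u a i -> dotv h (u i) = c) ->
  exists y b, [/\ solution_set X lambda (pen u) y a,
    solution_set X lambda (pen u) y b & a != b].
Proof.
move=> az h0 Xh hc; have [zu za] := az.
have hz : dotv h (X^T *m w) = 0 by rewrite dotvC dotv_trmxl Xh dotv0r.
have c0 : c = 0 by rewrite -hz (subdiff_eq az hc).
have [e e0 /(_ e _ e0 (lexx e)) act] := active_perturb u a h.
exists (X *m a + lambda *: w), (a + e *: h); split.
- exact: solution_of_subdiff az.
- apply: (@solution_of_subdiff _ _ _ _ _ _ _ lambda_gt0 _ w).
    by rewrite mulmxDr -scalemxAr Xh scaler0 addr0.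
  have [i ia'] := pen_attained u (a + e *: h); have ia := act _ ia'.
  split=> //; rewrite -(eqP ia') dotvDr dotvZr (eqP ia) -za dotvDl dotvZl hz.
  by rewrite [dotv _ h]dotvC (hc _ ia) c0.
- rewrite -subr_eq0 opprD addNKr oppr_eq0 scaler_eq0 negb_or h0 andbT.
  by rewrite gt_eqF.
Qed.

Theorem theorem6p1 (R : realType) (n p k : nat) (u : 'I_k.+1 -> 'cV[R]_p)
    (u0 : u ord0 = 0) (X : 'M[R]_(n, p)) (lambda : R) (lambda_gt0 : 0 < lambda) :
  (forall y : 'cV[R]_n, exists b : 'cV[R]_p,
     solution_set X lambda (pen u) y = [set b])
  <->
  (forall (F : set 'cV[R]_p) (d : nat),
     face (convex_hull u) F -> has_dim F d -> (d < dim_ker X)%N ->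
     row_set X `&` F = set0).
Proof.
split=> [uniq F d Fface [x [V [HV dV]]] d_lt|faces y].
  apply/seteqP; split=> // z [[w zE] Fz].
  have [a FE] := face_subdiff Fface Fz.
  have := d_lt; rewrite -dV => /exists_orthogonal[h [hK h0 hV]].
  have Xh : X *m h = 0 by apply/eqP; rewrite -mem_ker.
  have az : subdiff u a (X^T *m w) by rewrite -FE -zE.
  have hu i : active u a i -> dotv h (u i) = dotv h x.
    move=> /subdiff_vertex; rewrite -FE => Fui.
    have : affine_hull F (u i) by move=> A [_]; apply.
    by rewrite HV => -[v /= vV <-]; rewrite dotvDr (hV v vV) addr0.
  have [y [b [ya yb /eqP[]]]] := nonunique_of_face lambda_gt0 az h0 Xh hu.
  by have [b0 yE] := uniq y; move: ya yb; rewrite yE => -> ->.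
have [b sol_b] : exists b, solution_set X lambda (pen u) y b.
  apply: solution_exists => // h h0 Xh.
  rewrite lt0r pen_ge0// andbT; apply/eqP => pen0.
  apply: (no_orthogonal_face faces h0 Xh (a := h) (z := 0)).
  - by exists 0; rewrite mulmx0.
  - by split; [rewrite -u0; exact: vertex_hull|rewrite dotv0r pen0].
  - by move=> i /eqP; rewrite pen0 dotvC.
exists b; apply/seteqP; split=> [b' sol_b'|_ ->//] /=.
have [w [yE bz]] := subdiff_of_solution lambda_gt0 sol_b.
have [[zu zb] d_ge0] := (bz, dotv_ge0 (X *m (b' - b))).
have pen_ge := dotv_le_pen b' zu.
have : objective X lambda (pen u) y b' - objective X lambda (pen u) y b <= 0.
  by rewrite subr_le0; apply: sol_b'.
rewrite (objective_sub u yE) dotvBr ![dotv (X^T *m w) _]dotvC zb => obj_le.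
have : 0 <= lambda * (pen u b' - dotv b' (X^T *m w)).
  by rewrite mulr_ge0 ?subr_ge0// ltW.
move=> pen_term.
have Xh : X *m (b' - b) = 0 by apply/eqP; rewrite -dotv_eq0; apply/eqP; lra.
have zb' : dotv b' (X^T *m w) = pen u b'.
  have : lambda * (pen u b' - dotv b' (X^T *m w)) = 0 by lra.
  by move=> /eqP; rewrite mulf_eq0 gt_eqF//= subr_eq0 => /eqP.
apply: contrapT => /eqP; rewrite -subr_eq0 => h0.
apply: (no_orthogonal_face faces h0 Xh (a := b' + b) (z := X^T *m w)).
- by exists w.
- split=> //; apply/eqP; rewrite eq_le dotv_le_pen//= dotvDl zb zb'.
  have [i /eqP <-] := pen_attained u (b' + b).
  by rewrite dotvDr lerD ?le_pen.
- move=> i /eqP ia.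
  have := dotv_le_pen (b' + b) zu; rewrite dotvDl zb zb' -ia dotvDr => le_ui.
  have hz : dotv (b' - b) (X^T *m w) = 0 by rewrite dotvC dotv_trmxl Xh dotv0r.
  move: hz (le_pen u b' i) (le_pen u b i).
  by rewrite !dotvBl zb zb' ![dotv _ (u i)]dotvC; lra.
Qed.
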